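(* For every positive integer $n$, $T(n)=\sum_{r\geq1,\ r\mid n} T(r-1)$, where $T(0)=1$ by convention.
   Context: For a vector $A=(a_1,\ldots,a_k)$, $k\geq 1$, of positive integers define $f(A)$ recursively by $f(a_1)=a_1$ and $f(a_1,\ldots,a_{i+1})=(f(a_1,\ldots,a_i)+1)\,a_{i+1}$. For a positive integer $n$, $T(n)$ is the number of vectors $A$ (of any length $k\geq1$, with positive integer entries) such that $f(A)=n$; also $T(0):=1$. *)

(* Defs.v *)
From mathcomp Require Import all_boot finmap.
From mathcomp Require Import boolp classical_sets functions cardinality.

Set Implicit Arguments.
Unset Strict Implicit.
Unset Printing Implicit Defensive.

Local Open Scope nat_scope.
Local Open Scope classical_set_scope.

(* The value on the empty sequence is irrelevant: only nonempty sequences are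
   counted below; [f_seq1] and [f_rcons] are the defining recursion. *)
Definition f (A : seq nat) : nat :=
  if A is a :: s then foldl (fun x b => (x + 1) * b) a s else 0.

Lemma f_seq1 a : f [:: a] = a.
Proof. by []. Qed.

Lemma f_rcons A b : A != [::] -> f (rcons A b) = (f A + 1) * b.
Proof. by case: A => //= a s _; rewrite foldl_rcons. Qed.

Definition vectors_of_value (n : nat) : set (seq nat) :=
  [set A | [/\ A != [::], all (fun a => 0 < a) A & f A = n]].

(* [fset_set] is junk on infinite sets; [finite_vectors_of_value] below shows
   that the junk case never occurs. *)
Definition T (n : nat) : nat :=
  if n is 0 then 1 else #|` fset_set (vectors_of_value n)|.

Lemma f_bounds A : A != [::] -> all (fun a => 0 < a) A ->
  size A <= f A /\ all (fun a => a <= f A) A.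
Proof.
elim/last_ind: A => // A b IH _; rewrite all_rcons => /andP[b0 A0].
have [->/=|An0] := eqVneq A [::]; first by rewrite leqnn.
have [sA aA] := IH An0 A0; rewrite f_rcons // size_rcons all_rcons addn1.
have le1 : (f A).+1 <= (f A).+1 * b by rewrite leq_pmulr.
split; first exact: leq_trans le1.
rewrite leq_pmull //=; apply: sub_all aA => a /leqW aA.
exact: leq_trans le1.
Qed.

Lemma finite_vectors_of_value n : finite_set (vectors_of_value n).
Proof.
apply: (@sub_finite_set _ _
  ((fun s : n.-bseq 'I_n.+1 => map val s) @` setT)); last first.
  exact/finite_image/finite_finset.
move=> A [An0 A0 fA]; have := f_bounds An0 A0; rewrite fA => -[sA aA].
have sA' : size (map (@inord n) A) <= n by rewrite size_map.
exists (Bseq sA') => //=; rewrite -map_comp -[RHS]map_id.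
by apply/eq_in_map => a /(allP aA) an /=; rewrite inordK.
Qed.

(* Main.v *)
Require Import Defs.
From mathcomp Require Import all_boot.
From mathcomp Require Import finmap classical_sets cardinality.

(** Setting [f [::] = 0] makes [f (rcons B b) = (f B + 1) * b] hold also for
    empty [B], and makes [[::]] the only vector of value 0, in accordance with
    [T 0 = 1].  For [0 < n], removing the last entry is then a bijection from the
    vectors of value [n] onto the possibly empty vectors [B] with
    [r := f B + 1] dividing [n]; the removed entry is [n %/ r]. *)

Lemma f_rcons_total B b : f (rcons B b) = (f B + 1) * b.
Proof. by case: B => [|a s]; [rewrite mul1n | exact: f_rcons]. Qed.

Lemma f_gt0 A : A != [::] -> all (fun a => 0 < a) A -> 0 < f A.
Proof.
by case/lastP: A => // B b _; rewrite all_rcons f_rcons_total addn1 muln_gt0 => /andP[].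
Qed.

Definition fvectors (n : nat) : {fset seq nat} :=
  if n is 0 then [fset [::]]%fset else fset_set (vectors_of_value n).

Lemma card_fvectors n : #|` fvectors n| = T n.
Proof. by case: n => [|n] //=; rewrite cardfs1. Qed.

(** The nonemptiness condition is absorbed: with positive entries only [[::]] has value 0, and for
    positive [n] the value 0 of [[::]] already rules it out. *)
Lemma mem_fvectors n A :
  (A \in fvectors n) = all (fun a => 0 < a) A && (f A == n).
Proof.
case: n => [|n]; rewrite /fvectors.
  rewrite inE; have [->//|A0] := eqVneq A [::].
  by apply/esym/negP => /andP[/(f_gt0 A A0)]; case: (f A).
rewrite in_fset_set; last exact: finite_vectors_of_value.
apply/idP/andP => [|[Apos /eqP fA]]; first by rewrite inE => -[_ -> ->].
by rewrite inE; split=> //; apply/eqP => A0; rewrite A0 in fA.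
Qed.

Theorem theorem2 (n : nat) (hn : 0 < n) :
  T n = \sum_(1 <= r < n.+1 | r %| n) T (r - 1).
Proof.
set D := [seq r <- index_iota 1 n.+1 | r %| n].
have memD r : (r \in D) = (r %| n).
  rewrite mem_filter mem_index_iota; case: (boolP (r %| n)) => //= rn.
  by rewrite ltnS (dvdn_gt0 hn rn) dvdn_leq.
(* [B] determines [r], so distinct divisors contribute disjoint blocks to [L]. The truncated [r - 1]
   is harmless, since a divisor of a positive [n] is positive. *)
have memE r B : r \in D -> B \in enum_fset (fvectors (r - 1)) -> r = f B + 1.
  rewrite memD => rn; rewrite [_ \in _]mem_fvectors => /andP[_ /eqP ->].
  by rewrite subnK // (dvdn_gt0 hn rn).
set L := [seq rcons B (n %/ r) | r <- D, B <- enum_fset (fvectors (r - 1))].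
have uL : uniq L.
  apply: allpairs_uniq_dep => [|r _|].
  - by rewrite filter_uniq // iota_uniq.
  - exact: fset_uniq.
  move=> _ _ /allpairsPdep[r [B [rD BE ->]]] /allpairsPdep[r' [B' [rD' BE' ->]]].
  move=> /= /rcons_inj[eqB _]; move: (memE _ _ rD BE) (memE _ _ rD' BE').
  by rewrite -eqB => -> ->.
have perm_L : perm_eq (enum_fset (fvectors n)) L.
  apply: uniq_perm => // A; rewrite [LHS]mem_fvectors.
  apply/idP/allpairsPdep => [|[r [B [rD BE ->]]]].
    case/lastP: A => [|B b]; first by rewrite /= eq_sym -[_ == _]negbK -lt0n hn.
    rewrite all_rcons f_rcons_total => /andP[/andP[b0 Bpos] /eqP fBn].
    exists (f B + 1), B; split.
    - by rewrite memD -fBn dvdn_mulr.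
    - by rewrite [_ \in _]mem_fvectors Bpos addnK /=.
    - by rewrite -fBn mulKn // addn1.
  rewrite all_rcons f_rcons_total -(memE _ _ rD BE).
  move: BE; rewrite [_ \in _]mem_fvectors => /andP[-> _].
  move: rD; rewrite memD => rn.
  (* The appended quotient is a legal entry: [r <= n] makes it positive, and [r %| n] makes the
     product exactly [n]. *)
  by rewrite mulnC divnK // eqxx !andbT divn_gt0 ?(dvdn_gt0 hn rn) // dvdn_leq.
rewrite -card_fvectors (perm_size perm_L) size_allpairs_dep sumnE big_map big_filter.
by apply: eq_bigr => r _; rewrite card_fvectors.
Qed.
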